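(* Let $\mathbb{F}$ be a field and let $(V_\bullet,p_\bullet,\tau)$ be a zigzag module of type $\tau$ on vector spaces $V_0,\dots,V_\ell$ over $\mathbb{F}$, with $n_i=\dim V_i$. Let $A_\bullet=(A_1,\dots,A_\ell)$ be the matrices representing $p_1,\dots,p_\ell$ with respect to a choice of ordered bases of $V_0,\dots,V_\ell$, and let $\mathrm{Stab}(A_\bullet)$ be the stabiliser of $A_\bullet$ under the change-of-basis action of $G=\prod_{i=0}^{\ell}\mathrm{GL}(n_i;\mathbb{F})$. For $0\le i\le j\le\ell$ let $d_{ij}$ be the multiplicity of $[i,j]$ in the barcode of $(V_\bullet,p_\bullet,\tau)$ (with $d_{ij}=0$ if $[i,j]$ is not in the barcode). Then there is a bijection of sets $$\mathrm{Stab}(A_\bullet)\;\cong\;\prod_{0\le i\le j\le\ell}\mathrm{GL}(d_{ij};\mathbb{F})\;\times\prod_{\substack{[i_1,j_1]\preceq_\tau[i_2,j_2]\\ [i_1,j_1]\neq[i_2,j_2]}}\mathrm{Mat}(d_{i_1j_1}\times d_{i_2j_2};\mathbb{F}).$$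
   Context: A zigzag module of type $\tau$ consists of finite-dimensional $\mathbb{F}$-vector spaces $V_0,\dots,V_\ell$ and, for each $1\le i\le\ell$, a linear map $p_i$ which is either forward, $V_{i-1}\to V_i$, or backward, $V_{i-1}\leftarrow V_i$; the type $\tau$ records the direction of each $p_i$, written $i-1\to i$ or $i-1\leftarrow i$. The interval module $\mathbf{I}_\tau[i,j]_\bullet$ has $\mathbb{F}$ in positions $i,\dots,j$, $0$ elsewhere, and identity maps (in the directions given by $\tau$) between consecutive copies of $\mathbb{F}$. Every zigzag module of type $\tau$ is isomorphic to $\bigoplus_{i\le j}\mathbf{I}_\tau[i,j]_\bullet^{d_{ij}}$ for unique multiplicities $d_{ij}\ge0$; its barcode is the set of $[i,j]$ with $d_{ij}>0$. The matrix $A_i$ has size $n_i\times n_{i-1}$ if $p_i$ is forward and $n_{i-1}\times n_i$ if $p_i$ is backward. The group $G$ acts by $(gA)_i=g_iA_ig_{i-1}^{-1}$ if $p_i$ is forward, and $(gA)_i=g_{i-1}A_ig_i^{-1}$ if $p_i$ is backward; $\mathrm{Stab}(A_\bullet)=\{g\in G: (gA)_\bullet=A_\bullet\}$. The relation $\preceq_\tau$ on $\{[i,j]:0\le i\le j\le\ell\}$: $[i_1,j_1]\preceq_\tau[i_2,j_2]$ iff $[i_1,j_1]\cap[i_2,j_2]=[i,j]\neq\emptyset$, and ($i_1\le i_2$ if $i-1\to i$; $i_2\le i_1$ if $i-1\leftarrow i$), and ($j_1\le j_2$ if $j\to j+1$; $j_2\le j_1$ if $j\leftarrow j+1$). The condition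 on left endpoints is vacuous if $i=0$, and the one on right endpoints is vacuous if $j=\ell$. $\mathrm{GL}(0;\mathbb{F})$ is trivial and $\mathrm{Mat}(m\times n;\mathbb{F})$ is a singleton if $m=0$ or $n=0$. *)

(* Defs.v *)
From HB Require Import structures.
From mathcomp Require Import all_boot all_order all_algebra.

Set Implicit Arguments.
Unset Strict Implicit.
Unset Printing Implicit Defensive.

Import GRing.Theory.
Local Open Scope ring_scope.

(* The (external) direct sum of a finite family of vector spaces; the library
   only provides the vectType structure for constant families. *)
Section DirectSum.

Import VectorInternalTheory.

Variables (F : fieldType) (I : finType) (W : I -> vectType F).

Definition dirsum := {dffun forall x : I, W x}.

HB.instance Definition _ := Choice.on dirsum.

Implicit Types f g h : dirsum.

Definition dirsum_zero : dirsum := [ffun x : I => 0 : W x].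
Definition dirsum_opp f : dirsum := [ffun x : I => - f x : W x].
Definition dirsum_add f g : dirsum := [ffun x : I => f x + g x : W x].
Definition dirsum_scale (a : F) f : dirsum := [ffun x : I => a *: f x : W x].

Fact dirsum_addA : associative dirsum_add.
Proof. by move=> f g h; apply/ffunP=> x; rewrite !ffunE addrA. Qed.

Fact dirsum_addC : commutative dirsum_add.
Proof. by move=> f g; apply/ffunP=> x; rewrite !ffunE addrC. Qed.

Fact dirsum_add0 : left_id dirsum_zero dirsum_add.
Proof. by move=> f; apply/ffunP=> x; rewrite !ffunE add0r. Qed.

Fact dirsum_addN : left_inverse dirsum_zero dirsum_opp dirsum_add.
Proof. by move=> f; apply/ffunP=> x; rewrite !ffunE addNr. Qed.

HB.instance Definition _ := GRing.isZmodule.Build dirsum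
  dirsum_addA dirsum_addC dirsum_add0 dirsum_addN.

Fact dirsum_scaleA a c f :
  dirsum_scale a (dirsum_scale c f) = dirsum_scale (a * c) f.
Proof. by apply/ffunP=> x; rewrite !ffunE scalerA. Qed.

Fact dirsum_scale1 : left_id 1 dirsum_scale.
Proof. by move=> f; apply/ffunP=> x; rewrite !ffunE scale1r. Qed.

Fact dirsum_scaleDr : right_distributive dirsum_scale +%R.
Proof. by move=> a f g; apply/ffunP=> x; rewrite !ffunE scalerDr. Qed.

Fact dirsum_scaleDl f : {morph dirsum_scale^~ f : a c / a + c}.
Proof. by move=> a c; apply/ffunP=> x; rewrite !ffunE scalerDl. Qed.

HB.instance Definition _ := GRing.Zmodule_isLmodule.Build F dirsum
  dirsum_scaleA dirsum_scale1 dirsum_scaleDr dirsum_scaleDl.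

Lemma dirsumDE f g x : (f + g) x = f x + g x.
Proof. by rewrite [LHS]ffunE. Qed.

Lemma dirsumZE a f x : (a *: f) x = a *: f x.
Proof. by rewrite [LHS]ffunE. Qed.

Definition dirsum_dim : nat := \sum_(k < #|I|) dim (W (enum_val k)).

Fact dirsum_vect_iso : Vector.axiom dirsum_dim dirsum.
Proof.
pose W' (k : 'I_#|I|) := W (enum_val k).
pose to_row f : 'rV[F]_dirsum_dim :=
  \mxrow_k (@v2r F (W' k) (f (enum_val k))).
exists to_row => [a f g|].
  by apply/rowP=> k; rewrite !mxE dirsumDE dirsumZE linearP !mxE.
pose of_row (r : 'rV[F]_dirsum_dim) (x : I) : W x :=
  ecast y (W y) (enum_rankK x)
    (@r2v F (W' (enum_rank x)) (submxrow r (enum_rank x))).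
have of_rowE r k : of_row r (enum_val k) = @r2v F (W' k) (submxrow r k).
  rewrite /of_row; move: (enum_rankK _).
  by rewrite enum_valK => e; rewrite (eq_axiomK e).
exists (fun r => [ffun x : I => of_row r x] : dirsum) => [f|r].
  apply/ffunP=> x; rewrite ffunE -(enum_rankK x) of_rowE mxrowK; exact: v2rK.
by apply/mxrowP=> k; rewrite mxrowK ffunE of_rowE r2vK.
Qed.

HB.instance Definition _ :=
  Lmodule_hasFinDim.Build F dirsum dirsum_vect_iso.

End DirectSum.

Section Zigzag.

Variables (F : fieldType) (l : nat).

(* [tau k] tells whether the map between the positions k and k + 1, called
   p_(k+1) in the usual numbering of p_1, ..., p_l, points forward. *)
Definition zztype := 'I_l -> bool.

Variable tau : zztype.

Definition zsrc (k : 'I_l) : 'I_l.+1 :=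
  if tau k then widen_ord (leqnSn l) k else lift ord0 k.
Definition ztgt (k : 'I_l) : 'I_l.+1 :=
  if tau k then lift ord0 k else widen_ord (leqnSn l) k.

Record zigzag := Zigzag {
  zsp : 'I_l.+1 -> vectType F;
  zmap : forall k : 'I_l, 'Hom(zsp (zsrc k), zsp (ztgt k)) }.

Definition zz_iso (V W : zigzag) : Prop :=
  exists2 f : forall i : 'I_l.+1, 'Hom(zsp V i, zsp W i),
    forall i, bijective (f i) &
    forall (k : 'I_l) (v : zsp V (zsrc k)),
      f (ztgt k) (zmap V k v) = zmap W k (f (zsrc k) v).

Definition zz_sum (I : finType) (W : I -> zigzag) : zigzag :=
  Zigzag (zsp := fun i => dirsum (fun x => zsp (W x) i))
    (fun k => linfun (fun f : dirsum (fun x => zsp (W x) (zsrc k)) =>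
       [ffun x : I => zmap (W x) k (f x)]
         : dirsum (fun x => zsp (W x) (ztgt k)))).

(* The intervals [i, j] with 0 <= i <= j <= l. *)
Definition bar := {x : 'I_l.+1 * 'I_l.+1 | (x.1 <= x.2)%N}.

Definition lo (x : bar) : 'I_l.+1 := (val x).1.
Definition hi (x : bar) : 'I_l.+1 := (val x).2.

(* The space at position i has dimension 1 or 0 according to the truth value
   of lo x <= i <= hi x, and [pid_mx 1] is the 1 x 1 identity matrix when both
   dimensions are 1. *)
Definition interval_module (x : bar) : zigzag :=
  let n (i : 'I_l.+1) : nat := (lo x <= i <= hi x)%N in
  Zigzag (zsp := fun i => 'rV[F]_(n i))
    (fun k => linfun (mulmxr (pid_mx 1 : 'M[F]_(n (zsrc k), n (ztgt k))))).

(* V is isomorphic to the direct sum of d x copies of the interval module of x,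
   for every x; this determines d, which is the multiplicity function of the
   barcode of V. *)
Definition barcode_multiplicity (V : zigzag) (d : bar -> nat) : Prop :=
  zz_iso V (zz_sum (fun c : {x : bar & 'I_(d x)} => interval_module (tag c))).

Definition bar_prec (x y : bar) : bool :=
  let i := maxn (lo x) (lo y) in
  let j := minn (hi x) (hi y) in
  [&& (i <= j)%N,
      [forall k : 'I_l, (k.+1 == i) ==>
        (if tau k then lo x <= lo y else lo y <= lo x)%N] &
      [forall k : 'I_l, (k == j :> nat) ==>
        (if tau k then hi x <= hi y else hi y <= hi x)%N]].

Definition GL (n : nat) := {M : 'M[F]_n | M \in unitmx}.

Section Stabiliser.

Variable n : 'I_l.+1 -> nat.

Definition zz_matrices :=
  {dffun forall k : 'I_l, 'M[F]_(n (ztgt k), n (zsrc k))}.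

Definition zz_group := {dffun forall i : 'I_l.+1, GL (n i)}.

Definition zz_act (g : zz_group) (A : zz_matrices) : zz_matrices :=
  [ffun k : 'I_l => val (g (ztgt k)) *m A k *m invmx (val (g (zsrc k)))
     : 'M[F]_(n (ztgt k), n (zsrc k))].

Definition Stab (A : zz_matrices) := {g : zz_group | zz_act g A == A}.

End Stabiliser.

(* [passmx.mxof] acts on row vectors of coordinates, hence the transposition. *)
Definition zz_mx (V : zigzag)
    (b : forall i : 'I_l.+1, (\dim {:zsp V i}).-tuple (zsp V i)) :
    zz_matrices (fun i => \dim {:zsp V i}) :=
  [ffun k : 'I_l => (passmx.mxof (b (zsrc k)) (b (ztgt k)) (zmap V k))^T
     : 'M[F]_(\dim {:zsp V (ztgt k)}, \dim {:zsp V (zsrc k)})].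

End Zigzag.

(* Main.v *)
(* Writing the module as a sum of d x copies of the interval module of x, an
   endomorphism is a family of matrices with one d x by d y block for each pair
   of intervals x, y covering a given position. Compatibility with the maps
   forces the (x, y) block to be the same at all common positions, and to vanish
   unless x precedes y; conversely any such family of blocks is an endomorphism.
   The relation is antisymmetric and acyclic, because left and right endpoints
   are totally ordered by the directions of the arrows next to them. Hence
   endomorphisms are block triangular at each position, and invertible if and
   only if their diagonal blocks are. *)
From HB Require Import structures.
Require Import Defs.
From mathcomp Require Import all_boot all_order all_algebra zify.

Set Implicit Arguments.
Unset Strict Implicit.
Unset Printing Implicit Defensive.

Import GRing.Theory.

(** * The relation on intervals and a rank that it increases *)

Section Bars.

Variables (l : nat) (tau : zztype l).
Implicit Types (x y z : bar l) (k : 'I_l) (i j : 'I_l.+1).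

Local Notation src := (zsrc tau).
Local Notation tgt := (ztgt tau).

Definition covers x (i : nat) := (lo x <= i <= hi x)%N.

Lemma zsrcE k : src k = (if tau k then k : nat else k.+1) :> nat.
Proof. by rewrite /zsrc; case: (tau k). Qed.

Lemma ztgtE k : tgt k = (if tau k then k.+1 else k : nat) :> nat.
Proof. by rewrite /ztgt; case: (tau k). Qed.

Lemma bar_precP x y :
  reflect [/\ (maxn (lo x) (lo y) <= minn (hi x) (hi y))%N,
      forall k, k.+1 = maxn (lo x) (lo y) ->
        (if tau k then lo x <= lo y else lo y <= lo x)%N
    & forall k, k = minn (hi x) (hi y) :> nat ->
        (if tau k then hi x <= hi y else hi y <= hi x)%N]
    (bar_prec tau x y).
Proof.
apply: (iffP and3P) => [[? /forallP h1 /forallP h2] | [? h1 h2]]; split=> //.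
- by move=> k /eqP kE; move: (h1 k); rewrite kE.
- by move=> k /eqP kE; move: (h2 k); rewrite kE.
- by apply/forallP=> k; apply/implyP=> /eqP /h1.
- by apply/forallP=> k; apply/implyP=> /eqP /h2.
Qed.

Lemma lo_le_hi x : (lo x <= hi x)%N.
Proof. exact: (valP x). Qed.

Lemma bar_prec_refl x : bar_prec tau x x.
Proof.
apply/bar_precP; rewrite maxnn minnn lo_le_hi; split=> // k _; by case: ifP.
Qed.

Lemma bar_eqP x y : lo x = lo y :> nat -> hi x = hi y :> nat -> x = y.
Proof.
case: x y => [[a b] ab] [[a' b'] ab'] loE hiE; apply/val_inj => /=.
by congr (_, _); apply/val_inj.
Qed.

(* If the arrow entering (resp. leaving) the position [a] is forward, [a]
   becomes the largest (resp. smallest) left (resp. right) endpoint seen so far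
   when the positions are inserted from left to right (resp. right to left), and
   otherwise the other extremum: so endpoints are totally ordered by a signed
   distance to [0] (resp. [l]), shifted here by [l] to stay in [nat]. *)
Definition lo_rank (a : nat) : nat :=
  if [exists k : 'I_l, (k.+1 == a) && tau k] then l + a else l - a.

Definition hi_rank (a : nat) : nat :=
  if [exists k : 'I_l, (k == a :> nat) && tau k] then a else l + l - a.

Definition bar_rank x := lo_rank (lo x) + hi_rank (hi x).

Lemma lo_rank_bound a : (l - a <= lo_rank a <= l + a)%N.
Proof. by rewrite /lo_rank; case: ifP => _; lia. Qed.

Lemma hi_rank_bound (a : 'I_l.+1) : (a <= hi_rank a <= l + l - a)%N.
Proof. by rewrite /hi_rank; have := ltn_ord a; case: ifP => _; lia. Qed.

Lemma existsb_at (P : pred 'I_l) k :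
  [exists k' : 'I_l, (k' == k :> nat) && P k'] = P k.
Proof.
apply/existsP/idP => [[k' /andP[/eqP /val_inj ->]] // | Pk].
by exists k; rewrite eqxx.
Qed.

Lemma lo_rankS k : lo_rank k.+1 = (if tau k then l + k.+1 else l - k.+1)%N.
Proof. by rewrite /lo_rank -[tau k]existsb_at. Qed.

Lemma hi_rankE k : hi_rank k = (if tau k then k : nat else l + l - k)%N.
Proof. by rewrite /hi_rank existsb_at. Qed.

(** The larger endpoint is positive, and the arrow entering it decides both sides. If forward,
    [lo y] is the larger and its rank attains the upper bound of [lo_rank_bound]; if backward,
    [lo x] is the larger and its rank attains the lower bound. The smaller endpoint cannot reach
    either. *)
Lemma bar_prec_lo x y : bar_prec tau x y -> lo x != lo y ->
  (lo_rank (lo x) < lo_rank (lo y))%N.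
Proof.
case/bar_precP=> _ hl _ ne; have {}ne : lo x != lo y :> nat by [].
have [lxl lyl] := (ltn_ord (lo x), ltn_ord (lo y)).
have mxl : ((maxn (lo x) (lo y)).-1 < l)%N by lia.
pose k := Ordinal mxl.
have kE : k.+1 = maxn (lo x) (lo y) by rewrite /k /=; lia.
have := hl k kE; have := lo_rankS k; rewrite kE.
have := lo_rank_bound (lo x); have := lo_rank_bound (lo y).
by case: (tau k) => /=; case: (ltnP (lo x) (lo y)) => hxy; lia.
Qed.

Lemma bar_prec_hi x y : bar_prec tau x y -> hi x != hi y ->
  (hi_rank (hi x) < hi_rank (hi y))%N.
Proof.
case/bar_precP=> _ _ hr ne; have {}ne : hi x != hi y :> nat by [].
have [lxl lyl] := (ltn_ord (hi x), ltn_ord (hi y)).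
have mnl : ((minn (hi x) (hi y)) < l)%N by lia.
pose k := Ordinal mnl.
have kE : k = minn (hi x) (hi y) :> nat by rewrite /k /=; lia.
have := hr k kE; have := hi_rankE k; rewrite kE.
have := hi_rank_bound (hi x); have := hi_rank_bound (hi y).
by case: (tau k) => /=; case: (ltnP (hi x) (hi y)) => hxy; lia.
Qed.

Lemma bar_rank_lt x y :
  bar_prec tau x y -> x != y -> (bar_rank x < bar_rank y)%N.
Proof.
move=> xy ne; have hlo := bar_prec_lo xy; have hhi := bar_prec_hi xy.
rewrite /bar_rank; case: (eqVneq (lo x) (lo y)) hlo => [lE _|_ /(_ isT) hlo];
  case: (eqVneq (hi x) (hi y)) hhi => [hE _|_ /(_ isT) hhi].
- by case/eqP: ne; apply: bar_eqP; rewrite ?lE ?hE.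
- by rewrite lE ltn_add2l.
- by rewrite hE ltn_add2r.
- by rewrite -addSn leq_add // ltnW.
Qed.

Lemma bar_prec_anti x y : bar_prec tau x y -> bar_prec tau y x -> x = y.
Proof.
move=> xy yx; apply/eqP/negPn/negP=> ne.
have lt_xy := bar_rank_lt xy ne; rewrite eq_sym in ne.
by have := ltn_trans lt_xy (bar_rank_lt yx ne); rewrite ltnn.
Qed.

(** What makes a block placed at all common positions commute with the arrow [k]; used in
    [realize_endo]. *)
Lemma bar_prec_covers x y k : bar_prec tau x y ->
  covers x (tgt k) -> covers y (src k) -> covers y (tgt k) = covers x (src k).
Proof.
case/bar_precP=> _ /(_ k) hl /(_ k) hr; rewrite /covers zsrcE ztgtE.
by move: hl hr; case: (tau k); lia.
Qed.

Local Open Scope ring_scope.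

(** * Morphisms between interval modules *)

Section Homs.

(* [h i] is the component at the position [i] of an element of
   Hom(I_y, I_x) (x) M, where I_x and I_y are interval modules. *)
Variables (M : zmodType) (x y : bar l) (h : 'I_l.+1 -> M).

Hypothesis h_supp : forall i, ~~ (covers x i && covers y i) -> h i = 0.
Hypothesis h_comm :
  forall k, h (tgt k) *+ covers y (src k) = h (src k) *+ covers x (tgt k).

(** All positions from [i] to [j] lie in both intervals, so each arrow in between acts as the
    identity on both sides of [h_comm]. *)
Lemma interval_hom_const i j :
  covers x i -> covers y i -> covers x j -> covers y j -> h i = h j.
Proof.
wlog : i j / (i <= j)%N => [hw|].
  by case: (leqP i j) => [/hw//|/ltnW /hw ji ? ? ? ?]; apply/esym/ji.
move=> ij xi yi xj yj; move: j ij xj yj; case=> m ml /=.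
elim: m ml => [|m IH] ml ij xj yj; first by congr h; apply/val_inj => /=; lia.
case: (leqP i m) => [im|mi]; last by congr h; apply/val_inj => /=; lia.
have xm : covers x m by move: xi xj; rewrite /covers /=; lia.
have ym : covers y m by move: yi yj; rewrite /covers /=; lia.
rewrite (IH (ltnW ml)) //; pose k := Ordinal (ml : (m < l)%N).
have := h_comm k; rewrite zsrcE ztgtE /=.
rewrite /ztgt /zsrc; case: (tau k); rewrite !(xm, ym, xj, yj) /= !mulr1n.
  by move=> e; apply: etrans (etrans _ (esym e)) _; congr h; apply/val_inj.
by move=> e; apply: etrans (etrans _ e) _; congr h; apply/val_inj.
Qed.

Lemma interval_hom_prec i : h i != 0 -> bar_prec tau x y.
Proof.
move=> hi0.
have /andP[xi yi] : covers x i && covers y i.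
  by apply: contra_neqT hi0 => /h_supp.
have h0 j : covers x j -> covers y j -> h j != 0.
  by move=> xj yj; rewrite (interval_hom_const xj yj xi yi).
(* By constancy [h] is nonzero at every common position, so neither side of [h_comm] may vanish
   alone. At the arrows bounding the intersection, [xs] and [yt] are exactly the endpoint conditions
   of [bar_prec]. *)
have xs k : covers x (tgt k) -> covers y (tgt k) -> covers y (src k) ->
    covers x (src k).
  move=> xt yt ys; apply: contra_neqT (h0 _ xt yt) => xs.
  by have := h_comm k; rewrite ys xt (h_supp (i := src k)) // negb_and xs.
have yt k : covers x (src k) -> covers y (src k) -> covers x (tgt k) ->
    covers y (tgt k).
  move=> xs' ys xt; apply: contra_neqT (h0 _ xs' ys) => yt.
  have := h_comm k; rewrite ys xt (h_supp (i := tgt k)) //.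
  by rewrite negb_and yt orbT.
apply/bar_precP; split=> [|k kE|k kE].
- by move: xi yi; rewrite /covers; lia.
- move: (xs k) (yt k) xi yi; rewrite /covers zsrcE ztgtE.
  by case: (tau k); lia.
- move: (xs k) (yt k) xi yi; rewrite /covers zsrcE ztgtE.
  by case: (tau k); lia.
Qed.

End Homs.
End Bars.

(** * Square matrices cut into blocks by intervals *)

Section Blocks.

Local Open Scope ring_scope.

Variables (F : fieldType) (l : nat) (tau : zztype l) (d : bar l -> nat).
Implicit Types (x y z : bar l) (k : 'I_l) (i : 'I_l.+1).

Local Notation src := (zsrc tau).
Local Notation tgt := (ztgt tau).

Definition copies := {x : bar l & 'I_(d x)}.
Local Notation N0 := #|{: copies}|.

Definition pos x (u : 'I_(d x)) : 'I_N0 :=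
  enum_rank (Tagged (fun x => 'I_(d x)) u : copies).

Definition blk x y (M : 'M[F]_N0) : 'M_(d x, d y) := mxsub (@pos x) (@pos y) M.

Definition supp_mx i : 'M[F]_N0 :=
  diag_mx (\row_c (covers (tag (enum_val c)) i)%:R).

Lemma posP (c : 'I_N0) : exists x (u : 'I_(d x)), c = pos u.
Proof.
case cE : (enum_val c) => [x u]; exists x, u.
by apply: enum_val_inj; rewrite enum_rankK cE.
Qed.

(** Only the inner index is cut into blocks; [f] and [g] stay arbitrary so that this also applies to
    the rectangular [W] of [realize_unit]. *)
Lemma mxsub_mul p q p' q' (f : 'I_p' -> 'I_p) (g : 'I_q' -> 'I_q)
    (M : 'M[F]_(p, N0)) (N : 'M[F]_(N0, q)) :
  mxsub f g (M *m N) = \sum_z mxsub f (@pos z) M *m mxsub (@pos z) g N.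
Proof.
apply/matrixP=> a b; rewrite !mxE summxE.
rewrite (reindex (@enum_rank copies)) /=; last exact/onW_bij/enum_rank_bij.
under [RHS]eq_bigr => z _ do rewrite mxE.
rewrite sig_big_dep /=.
by apply: eq_bigr => -[x u] _; rewrite !mxE.
Qed.

Lemma blk_eq (M N : 'M[F]_N0) : (forall x y, blk x y M = blk x y N) -> M = N.
Proof.
move=> e; apply/matrixP=> a b.
have [[x [u ->]] [y [v ->]]] := (posP a, posP b).
by have /matrixP/(_ u v) := e x y; rewrite !mxE.
Qed.

Lemma mxsub_supp_mul x i q q' (g : 'I_q' -> 'I_q) (M : 'M[F]_(N0, q)) :
  mxsub (@pos x) g (supp_mx i *m M) = mxsub (@pos x) g M *+ covers x i.
Proof.
apply/matrixP=> a b; rewrite mul_diag_mx mulmxnE !mxE enum_rankK /=.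
by rewrite mulr_natl.
Qed.

Lemma mxsub_mul_supp y i p p' (f : 'I_p' -> 'I_p) (M : 'M[F]_(p, N0)) :
  mxsub f (@pos y) (M *m supp_mx i) = mxsub f (@pos y) M *+ covers y i.
Proof.
apply/matrixP=> a b; rewrite mul_mx_diag mulmxnE !mxE enum_rankK /=.
by rewrite mulr_natr.
Qed.

Lemma blk_supp x i : blk x x (supp_mx i) = (covers x i)%:R%:M.
Proof.
apply/matrixP=> a b; rewrite !mxE enum_rankK.
by rewrite (inj_eq enum_rank_inj) eq_Tagged.
Qed.

(* A frame identifies the zigzag of matrices [A] with the direct sum of [d x]
   copies of the interval module of [x] for every [x]: the columns of [E i] and
   the rows of [D i] are indexed by all the copies, including those that vanish
   at the position [i]. *)
Record frame (n : 'I_l.+1 -> nat) (A : zz_matrices F tau n) := Frame {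
  frE : forall i, 'M[F]_(n i, N0);
  frD : forall i, 'M[F]_(N0, n i);
  frED : forall i, frE i *m frD i = 1%:M;
  frDE : forall i, frD i *m frE i = supp_mx i;
  frA : forall k, A k = frE (tgt k) *m frD (src k) }.

(** * Endomorphisms read through a frame *)

Section Endomorphisms.

Variables (n : 'I_l.+1 -> nat) (A : zz_matrices F tau n) (fr : frame A).
Local Notation E := (frE fr).
Local Notation D := (frD fr).

Definition zz_endo (g : forall i, 'M[F]_(n i)) :=
  forall k, g (tgt k) *m A k = A k *m g (src k).

Definition component (g : forall i, 'M[F]_(n i)) x y i :=
  blk x y (D i *m g i *m E i).

Lemma frame_suppE i : E i *m supp_mx i = E i.
Proof. by rewrite -(frDE fr) mulmxA frED mul1mx. Qed.

Lemma frame_suppD i : supp_mx i *m D i = D i.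
Proof. by rewrite -(frDE fr) -mulmxA frED mulmx1. Qed.

Lemma component_supp g x y i :
  ~~ (covers x i && covers y i) -> component g x y i = 0.
Proof.
rewrite /component -[D i]frame_suppD -[E i]frame_suppE !mulmxA /blk.
rewrite mxsub_mul_supp -!mulmxA mxsub_supp_mul.
by case: covers; case: covers; rewrite ?mulr0n ?mul0rn.
Qed.

Lemma component_comm g x y k : zz_endo g ->
  component g x y (tgt k) *+ covers y (src k) =
  component g x y (src k) *+ covers x (tgt k).
Proof.
move=> /(_ k) gk; rewrite /component /blk -mxsub_mul_supp -mxsub_supp_mul.
congr mxsub; rewrite -!(frDE fr).
transitivity (D (tgt k) *m (g (tgt k) *m A k) *m E (src k)).
  by rewrite (frA fr) !mulmxA.
by rewrite gk (frA fr) !mulmxA.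
Qed.

Lemma component_mul g g' x y i :
  component (fun i => g i *m g' i) x y i =
  \sum_z component g x z i *m component g' z y i.
Proof.
rewrite /component /blk -mxsub_mul; congr mxsub.
by rewrite -!mulmxA [E i *m (D i *m _)]mulmxA frED mul1mx.
Qed.

Lemma component_prec g x y i :
  zz_endo g -> component g x y i != 0 -> bar_prec tau x y.
Proof.
move=> gA; apply: interval_hom_prec => [j|k]; first exact: component_supp.
exact: component_comm.
Qed.

(** The leftmost common position of intervals that meet. For an endomorphism, any other common
    position gives the same [coef]. *)
Definition meet_pos x y := if (lo x <= lo y)%N then lo y else lo x.

Lemma covers_meet_pos x y : bar_prec tau x y ->
  covers x (meet_pos x y) && covers y (meet_pos x y).
Proof.
case/bar_precP=> h _ _; have := lo_le_hi x; have := lo_le_hi y.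
by rewrite /meet_pos /covers; case: (leqP (lo x) (lo y)) => ?; lia.
Qed.

Definition coef g x y := component g x y (meet_pos x y).

Lemma componentE g x y i : zz_endo g ->
  component g x y i =
  coef g x y *+ (bar_prec tau x y && covers x i && covers y i).
Proof.
move=> gA; case: (boolP (bar_prec tau x y)) => /= [xy|]; last first.
  move=> nxy; rewrite mulr0n; apply: contraNeq nxy; exact: component_prec.
case: (boolP (covers x i && covers y i)) => [/andP[xi yi]|/component_supp//].
have /andP[xm ym] := covers_meet_pos xy; rewrite mulr1n /coef.
by apply: (interval_hom_const _ xi yi xm ym) => k; apply: component_comm.
Qed.

Lemma coef_eq g g' : zz_endo g -> zz_endo g' ->
  (forall x y, bar_prec tau x y -> coef g x y = coef g' x y) ->
  forall i, g i = g' i.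
Proof.
move=> gA gA' e i.
have : D i *m g i *m E i = D i *m g' i *m E i.
  apply: blk_eq => x y.
  rewrite -![blk _ _ _]/(component _ _ _ _) !componentE //.
  by case: (boolP (bar_prec tau x y)) => //= /e ->.
move/(congr1 (fun M => E i *m M *m D i)).
by rewrite !mulmxA frED !mul1mx -!mulmxA frED !mulmx1.
Qed.

Lemma meet_pos_id x : meet_pos x x = lo x.
Proof. by rewrite /meet_pos leqnn. Qed.

(** In the diagonal block of the product, a term indexed by [z] needs [x] to precede [z] and [z] to
    precede [x]; antisymmetry leaves [z = x], so the diagonal blocks of [g] and [g'] are mutually
    inverse. *)
Lemma coef_unit g g' x : zz_endo g -> zz_endo g' ->
  (forall i, g i *m g' i = 1%:M) -> coef g x x \in unitmx.
Proof.
move=> gA gA' gg'; suff /mulmx1_unit[] : coef g x x *m coef g' x x = 1%:M by [].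
have xlo : covers x (lo x) by rewrite /covers leqnn lo_le_hi.
transitivity (component (fun i => g i *m g' i) x x (lo x)); last first.
  by rewrite /component gg' mulmx1 frDE blk_supp xlo.
rewrite component_mul (bigD1 x) //= big1 ?addr0 => [|z zx].
  by rewrite /coef meet_pos_id.
rewrite componentE // [X in _ *m X]componentE //.
case: (boolP (bar_prec tau x z)) => xz; last by rewrite mulr0n mul0mx.
case: (boolP (bar_prec tau z x)) => zx'; last by rewrite mulr0n mulmx0.
by rewrite (bar_prec_anti xz zx') eqxx in zx.
Qed.

(** * Automorphisms built from prescribed blocks *)

Section Realize.

Variable N : 'M[F]_N0.
Hypothesis N_prec : forall x y, ~~ bar_prec tau x y -> blk x y N = 0.

Definition realize i := E i *m N *m D i.

Lemma component_realize x y i :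
  component realize x y i = blk x y N *+ (covers x i && covers y i).
Proof.
rewrite /component /realize /blk.
transitivity (mxsub (@pos x) (@pos y) (supp_mx i *m N *m supp_mx i)).
  by rewrite -(frDE fr) !mulmxA.
by rewrite mxsub_mul_supp mxsub_supp_mul -mulrnA mulnb.
Qed.

Lemma realize_endo : zz_endo realize.
Proof.
move=> k; rewrite (frA fr) /realize.
(* The outer factors [supp_mx] are absorbed by [E] and [D] afterwards. They confine the comparison
   to [x] covering the target and [y] covering the source, as [bar_prec_covers] requires. *)
have e : supp_mx (tgt k) *m N *m supp_mx (tgt k) *m supp_mx (src k) =
         supp_mx (tgt k) *m supp_mx (src k) *m N *m supp_mx (src k).
  apply: blk_eq => x y; rewrite /blk !mxsub_mul_supp -!mulmxA !mxsub_supp_mul.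
  case: (boolP (bar_prec tau x y)) => [xy|/N_prec nxy]; last first.
    by rewrite -!/(blk x y _) nxy !mul0rn.
  have := bar_prec_covers (k := k) xy.
  case: (covers x (tgt k)); case: (covers y (src k));
    rewrite ?mulr0n ?mul0rn //.
  by move=> ->.
have := congr1 (fun M => E (tgt k) *m M *m D (src k)) e.
rewrite !mulmxA !frame_suppE -!mulmxA !frame_suppD !mulmxA.
by rewrite -!(frDE fr) !mulmxA.
Qed.

Lemma coef_realize x y : bar_prec tau x y -> coef realize x y = blk x y N.
Proof. by move=> /covers_meet_pos xy; rewrite /coef component_realize xy. Qed.

Hypothesis N_unit : forall x, blk x x N \in unitmx.

(** Back substitution: the cokernel matrix [K] yields a block column [W] killed by the rows of [N]
    whose interval covers [i]. Blocks of [W] of higher rank vanish by induction, and the invertible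
    diagonal block then kills the current one. *)
Lemma realize_unit i : realize i \in unitmx.
Proof.
rewrite -row_full_unit -cokermx_eq0; set K := cokermx _.
pose W := D i *m K.
have K_W : K = E i *m W by rewrite mulmxA frED mul1mx.
pose Wx x := mxsub (@pos x) id W.
have Wx0 x : ~~ covers x i -> Wx x = 0.
  by move=> xi; rewrite /Wx /W -frame_suppD -mulmxA mxsub_supp_mul (negPf xi).
suff Wx00 x : Wx x = 0.
  rewrite K_W (_ : W = 0) ?mulmx0 //; apply/matrixP=> a b.
  by have [x [u ->]] := posP a; have /matrixP/(_ u b) := Wx00 x; rewrite !mxE.
move: x; have sum0 x : covers x i -> \sum_z blk x z N *m Wx z = 0.
  move=> xi; rewrite -mxsub_mul.
  have : supp_mx i *m (N *m W) = 0.
    rewrite -(frDE fr) -!mulmxA [E i *m _]mulmxA [_ *m (D i *m K)]mulmxA.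
    by rewrite mulmx_coker mulmx0.
  move/(congr1 (mxsub (@pos x) id)); rewrite mxsub_supp_mul xi mulr1n => ->.
  by apply/matrixP=> a b; rewrite !mxE.
(* Both endpoint ranks are at most [2 * l], so [4 * l] bounds [bar_rank] and the difference drops
   strictly as the rank grows. *)
move=> x; have [r] := ubnP (4 * l - bar_rank tau x)%N.
elim: r x => // r IH x xr.
case: (boolP (covers x i)) => [xi|]; last exact: Wx0.
have := sum0 x xi; rewrite (bigD1 x) //= big1 ?addr0 => [|z zx].
  by move/(congr1 (mulmx (invmx (blk x x N)))); rewrite mulKmx ?mulmx0.
case: (boolP (bar_prec tau x z)) => [xz|/N_prec->]; last by rewrite mul0mx.
have := bar_rank_lt xz; rewrite eq_sym => /(_ zx) lt.
rewrite IH ?mulmx0 //; move: xr lt.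
have := lo_rank_bound tau (lo x); have := hi_rank_bound tau (hi x).
have := lo_rank_bound tau (lo z); have := hi_rank_bound tau (hi z).
have := ltn_ord (lo x); have := ltn_ord (lo z).
by rewrite /bar_rank; lia.
Qed.

End Realize.

End Endomorphisms.

End Blocks.

(** Meant for the maps of [zz_sum], which are given by bare functions whose linearity is proved on
    the spot. *)
Lemma linfunE (F : fieldType) (U W : vectType F) (f : U -> W) :
  linear f -> linfun f =1 f.
Proof.
move=> f_lin; pose L := GRing.isLinear.Build F U W _ f f_lin.
pose f' : {linear U -> W} := HB.pack f L.
exact: (lfunE f').
Qed.

(** * A frame from the barcode decomposition *)

Section FrameExists.

Local Open Scope ring_scope.

Variables (F : fieldType) (l : nat) (tau : zztype l) (d : bar l -> nat).
Implicit Types (x y z : bar l) (k : 'I_l) (i : 'I_l.+1).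

Local Notation src := (zsrc tau).
Local Notation tgt := (ztgt tau).
Local Notation copy_module :=
  (fun c : copies d => interval_module F tau (tag c)).
Local Notation model := (zz_sum copy_module).

(** Summing the entries gives one scalar coordinate for dimensions 0 and 1 alike, with no transport
    between them. *)
Lemma rV_le1 m (v w : 'rV[F]_(m : bool)) :
  \sum_k v 0 k = \sum_k w 0 k -> v = w.
Proof.
case: m v w => v w; last by move=> _; apply/rowP=> -[].
by rewrite !big_ord1 => e; apply/rowP=> a; rewrite ord1.
Qed.

Lemma rV_sum_dim (m : bool) (v : 'rV[F]_m) :
  (\sum_k v 0 k) *+ m = \sum_k v 0 k.
Proof. by case: m v => v; rewrite ?big_ord0. Qed.

Lemma pid_mx_sum (m p : bool) (v : 'rV[F]_m) :
  \sum_k (v *m (pid_mx 1 : 'M_(m, p))) 0 k = (\sum_k v 0 k) *+ p.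
Proof.
case: p; last by rewrite big_ord0.
case: m v => v; last first.
  by rewrite big_ord0 mul0rn; apply: big1 => k _; rewrite mxE big_ord0.
by rewrite pid_mx_1 mulmx1.
Qed.

(** The generator of the copy [c]. It is zero when [c] misses the position [i], so the family spans
    but need not be free. *)
Definition copy_vec i (c : copies d) : zsp model i :=
  [ffun c' : copies d => const_mx (c' == c)%:R : zsp (copy_module c') i].

(* The sum has at most one term. *)
Definition copy_coord i (c : copies d) (w : zsp model i) : F :=
  \sum_k (w c : 'rV[F]_(covers (tag c) i)) 0 k.

Lemma copy_coord_sum i c (J : finType) (a : J -> F) (v : J -> zsp model i) :
  copy_coord c (\sum_j a j *: v j) = \sum_j a j * copy_coord c (v j).
Proof.
elim/big_rec2: _ => [|j r w _ <-]; rewrite /copy_coord.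
  by apply: big1 => k _; rewrite ffunE mxE.
rewrite mulr_sumr -big_split /=; apply: eq_bigr => k _.
by rewrite dirsumDE dirsumZE !mxE.
Qed.

Lemma copy_coord_vec i c c' :
  copy_coord c (copy_vec i c') = (c == c')%:R *+ covers (tag c) i.
Proof.
rewrite /copy_coord ffunE.
under eq_bigr => k _ do rewrite mxE.
by rewrite sumr_const card_ord.
Qed.

Lemma copy_coord_inj i (v w : zsp model i) :
  (forall c, copy_coord c v = copy_coord c w) -> v = w.
Proof. by move=> e; apply/ffunP=> c; apply: rV_le1; apply: e. Qed.

Lemma copy_vec_sum i (w : zsp model i) :
  \sum_c copy_coord c w *: copy_vec i c = w.
Proof.
apply: copy_coord_inj => c; rewrite copy_coord_sum (bigD1 c) //= big1.
  rewrite copy_coord_vec eqxx addr0 mulrnAr mulr1.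
  exact: rV_sum_dim.
by move=> c' cc'; rewrite copy_coord_vec eq_sym (negPf cc') mul0rn mulr0.
Qed.

Lemma zmap_model k (w : zsp model (src k)) :
  zmap model k w = \sum_c copy_coord c w *: copy_vec (tgt k) c.
Proof.
apply: copy_coord_inj => c; rewrite copy_coord_sum (bigD1 c) //=.
rewrite big1; last first.
  by move=> c' cc'; rewrite copy_coord_vec eq_sym (negPf cc') mul0rn mulr0.
rewrite copy_coord_vec eqxx addr0 mulrnAr mulr1 /copy_coord.
rewrite linfunE => [|a v v']; first by rewrite ffunE lfunE; apply: pid_mx_sum.
by apply/ffunP=> c'; rewrite dirsumDE dirsumZE !ffunE linearP.
Qed.

Variable V : zigzag F tau.
Variable b : forall i, (\dim {:zsp V i}).-tuple (zsp V i).
Hypothesis hb : forall i, basis_of {:zsp V i} (b i).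

Lemma frame_exists : barcode_multiplicity V d -> inhabited (frame d (zz_mx b)).
Proof.
case=> f f_bij f_comm.
have fK i : cancel (f i) (f i)^-1%VF.
  by apply: lker0_lfunK; apply/lker0P/bij_inj.
have fVK i : cancel (f i)^-1%VF (f i).
  by move=> w; have [g gK Kg] := f_bij i; rewrite -{1}(Kg w) fK Kg.
have b_coord i v : v = \sum_j coord (b i) j v *: (b i)`_j.
  by apply: (coord_basis (hb i)); rewrite memvf.
(* [E i] is the matrix of the inverse of [f i] from the generators to the basis [b i], and [D i]
   that of [f i] the other way. *)
pose E i := \matrix_(j < \dim {:zsp V i}, c < #|{: copies d}|)
  coord (b i) j ((f i)^-1%VF (copy_vec i (enum_val c))).
pose D i := \matrix_(c < #|{: copies d}|, j < \dim {:zsp V i})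
  copy_coord (enum_val c) (f i (b i)`_j).
have E_sum i j w : \sum_c copy_coord c w *
    coord (b i) j ((f i)^-1%VF (copy_vec i c)) = coord (b i) j ((f i)^-1%VF w).
  rewrite -[in RHS](copy_vec_sum w) !linear_sum.
  by apply: eq_bigr => c _; rewrite !linearZ.
have D_sum i c w : \sum_j coord (b i) j ((f i)^-1%VF w) *
    copy_coord c (f i (b i)`_j) = copy_coord c w.
  rewrite -copy_coord_sum -[in RHS](fVK i w) [in RHS](b_coord i (_ w)).
  rewrite linear_sum; congr copy_coord.
  by apply: eq_bigr => j _; rewrite linearZ.
constructor; exists E D => [i|i|k].
- apply/matrixP=> j j'; rewrite !mxE.
  transitivity (coord (b i) j ((f i)^-1%VF (f i (b i)`_j'))).
    rewrite -E_sum [in RHS]big_enum_val /=.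
    by apply: eq_bigr => c _; rewrite !mxE mulrC.
  by rewrite fK coord_free ?(basis_free (hb i)) // eq_sym.
- apply/matrixP=> c c'; rewrite !mxE.
  transitivity (copy_coord (enum_val c) (copy_vec i (enum_val c'))).
    by rewrite -D_sum; apply: eq_bigr => j _; rewrite !mxE mulrC.
  rewrite copy_coord_vec (inj_eq enum_val_inj).
  by case: eqVneq => // _; rewrite mul0rn.
- apply/matrixP=> j j'; rewrite /zz_mx ffunE !mxE /=.
  rewrite passmx.vecof_delta.
  transitivity (coord (b (tgt k)) j ((f (tgt k))^-1%VF
      (\sum_c copy_coord c (f (src k) (b (src k))`_j') *: copy_vec (tgt k) c))).
    by rewrite -zmap_model -f_comm fK.
  rewrite !linear_sum [LHS]big_enum_val /=.
  by apply: eq_bigr => c _; rewrite !linearZ !mxE mulrC.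
Qed.

End FrameExists.

(** * The bijection from the stabiliser to block data *)

Section StabiliserBijection.

Local Open Scope ring_scope.

Variables (F : fieldType) (l : nat) (tau : zztype l) (d : bar l -> nat).
Variables (n : 'I_l.+1 -> nat) (A : zz_matrices F tau n) (fr : frame d A).
Implicit Types (x y z : bar l) (k : 'I_l) (i : 'I_l.+1).

Definition to_GL m (M : 'M[F]_m) (M_unit : M \in unitmx) : GL F m :=
  exist (fun M => is_true (M \in unitmx)) M M_unit.

Definition group_mx (g : zz_group F n) i : 'M[F]_(n i) := val (g i).

Lemma zz_actP (g : zz_group F n) :
  reflect (zz_endo A (group_mx g)) (zz_act g A == A).
Proof.
have gU i : val (g i) \in unitmx by apply: valP.
apply: (iffP eqP) => [/ffunP gA k|gA].
  by have := gA k; rewrite ffunE => e; rewrite -[in RHS]e mulmxKV.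
apply/ffunP=> k; rewrite ffunE.
by have := gA k; rewrite /group_mx => ->; rewrite mulmxK.
Qed.

Definition off_diagonal :=
  {q : bar l * bar l | bar_prec tau q.1 q.2 && (q.1 != q.2)}.

Definition block_data :=
  ({dffun forall x : bar l, GL F (d x)} *
   {dffun forall q : off_diagonal, 'M[F]_(d (val q).1, d (val q).2)})%type.

Lemma stab_endo (g : Stab A) : zz_endo A (group_mx (val g)).
Proof. exact/zz_actP/(valP g). Qed.

Lemma stab_coef_unit (g : Stab A) x :
  coef fr (group_mx (val g)) x x \in unitmx.
Proof.
have gA := stab_endo g.
have gU i : group_mx (val g) i \in unitmx by exact: (valP (val g i)).
pose g' i := invmx (group_mx (val g) i).
apply: (@coef_unit _ _ _ _ _ _ fr _ g') => // [k|i]; last exact: mulmxV.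
(* Multiplying the commutation relation by the inverses on both sides shows that [g'] is an
   endomorphism too. *)
have /(congr1 (fun M => g' (ztgt tau k) *m M *m g' (zsrc tau k))) := gA k.
by rewrite mulKmx // !mulmxA mulmxK.
Qed.

Definition stab_blocks (g : Stab A) : block_data :=
  ([ffun x : bar l => to_GL (stab_coef_unit g x)],
   [ffun q : off_diagonal => coef fr (group_mx (val g)) (val q).1 (val q).2
      : 'M[F]_(d (val q).1, d (val q).2)]).

Lemma stab_blocks_inj : injective stab_blocks.
Proof.
move=> g g' [/ffunP e1 /ffunP e2]; apply/val_inj/ffunP=> i; apply/val_inj.
apply: (coef_eq (fr := fr) (stab_endo g) (stab_endo g')) => x y xy.
have [<-|ne] := eqVneq x y.
  by have := congr1 val (e1 x); rewrite !ffunE.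
have q_off : bar_prec tau (x, y).1 (x, y).2 && ((x, y).1 != (x, y).2).
  by rewrite /= xy.
by have := e2 (exist _ (x, y) q_off); rewrite !ffunE.
Qed.

Lemma block_matrix (B : forall x y, 'M[F]_(d x, d y)) :
  exists M, forall x y, blk x y M = B x y.
Proof.
pose c0 (c : 'I_#|{: copies d}|) := enum_val c.
exists (\matrix_(c, c')
  B (tag (c0 c)) (tag (c0 c')) (tagged (c0 c)) (tagged (c0 c'))).
by move=> x y; apply/matrixP=> u v; rewrite !mxE /c0 !enum_rankK.
Qed.

Lemma assemble_blocks (D : block_data) :
  exists M, [/\ forall x, blk x x M = val (D.1 x),
    forall q : off_diagonal, blk (val q).1 (val q).2 M = D.2 q
  & forall x y, ~~ bar_prec tau x y -> blk x y M = 0].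
Proof.
pose T (q : bar l * bar l) := 'M[F]_(d q.1, d q.2).
(* The type of [B] depends on [q], so agreement with the data is stated between tagged matrices;
   [eq_Tagged] recovers plain equalities once [q] is concrete. *)
pose P q (B : T q) := [/\
  forall x, q = (x, x) -> Tagged T B = Tagged T (val (D.1 x) : T (x, x)),
  forall q', q = val q' -> Tagged T B = Tagged T (D.2 q' : T (val q'))
  & ~~ bar_prec tau q.1 q.2 -> B = 0].
have [q|B BP] := fin_all_exists (P := P).
  have [e|ne] := eqVneq q.1 q.2.
    case: q e => x y /= <-; exists (val (D.1 x)); split=> /=.
    - by move=> x' [->].
    - move=> q' e; exfalso; have := valP q'.
      by rewrite [val q'](esym e) /= eqxx andbF.
    - by rewrite bar_prec_refl.
  case: (boolP (bar_prec tau q.1 q.2)) => [pq|npq]; last first.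
    exists 0; split=> // [x e|q' e]; first by rewrite e eqxx in ne.
    exfalso; have := valP q'.
    by rewrite [val q'](esym e) (negPf npq).
  have q_off : bar_prec tau q.1 q.2 && (q.1 != q.2) by rewrite pq.
  exists (D.2 (exist _ q q_off)); split=> [x e|q' e|].
  - by rewrite e eqxx in ne.
  - by have -> : q' = exist _ q q_off by apply: val_inj.
  - by rewrite pq.
have [M MB] := block_matrix (fun x y => B (x, y)).
exists M; split=> [x|q|x y npq]; rewrite MB.
- by have [/(_ x erefl) /eqP] := BP (x, x); rewrite eq_Tagged /= => /eqP.
- case: q => [[x y] pq] /=; have [_ h _] := BP (x, y).
  by have /eqP := h (exist _ (x, y) pq) erefl; rewrite eq_Tagged /= => /eqP.
- by have [_ _ ->] := BP (x, y).
Qed.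

(** Boolean equality lets [xchoose] extract the preimage that defines the inverse map. *)
Lemma stab_blocks_surj D : exists g, stab_blocks g == D.
Proof.
have [M [M_diag M_off M_prec]] := assemble_blocks D.
have M_unit x : blk x x M \in unitmx by rewrite M_diag; apply: valP.
pose g : zz_group F n :=
  [ffun i => to_GL (realize_unit fr M_prec M_unit i)].
have gE i : group_mx g i = realize fr M i by rewrite /group_mx ffunE.
have gA : zz_act g A == A.
  by apply/zz_actP => k; rewrite !gE; apply: realize_endo.
have gcoef x y : coef fr (group_mx g) x y = coef fr (realize fr M) x y.
  by rewrite /coef /component gE.
exists (exist _ g gA); apply/eqP; case: D M_diag M_off => D1 D2 /= M_diag M_off.
congr (_, _); apply/ffunP; [move=> x | move=> q]; rewrite ffunE.
  apply: val_inj => /=.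
  by rewrite gcoef coef_realize ?bar_prec_refl.
rewrite /= gcoef coef_realize //.
by have /andP[] := valP q.
Qed.

Lemma stab_blocks_bij : bijective stab_blocks.
Proof.
exists (fun D => xchoose (stab_blocks_surj D)) => [g|D].
  by apply: stab_blocks_inj; apply/eqP/(xchooseP (stab_blocks_surj _)).
exact/eqP/(xchooseP (stab_blocks_surj _)).
Qed.

End StabiliserBijection.

Theorem theorem5p11 (F : fieldType) (l : nat) (tau : zztype l)
    (V : zigzag F tau)
    (b : forall i : 'I_l.+1, (\dim {:zsp V i}).-tuple (zsp V i))
    (hb : forall i : 'I_l.+1, basis_of {:zsp V i} (b i))
    (d : bar l -> nat) (hd : barcode_multiplicity V d) :
  exists f : Stab (zz_mx b) ->
      {dffun forall x : bar l, GL F (d x)} *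
      {dffun forall q : {q : bar l * bar l |
                          bar_prec tau q.1 q.2 && (q.1 != q.2)},
         'M[F]_(d (val q).1, d (val q).2)},
    bijective f.
Proof.
have [fr] := frame_exists hb hd.
by exists (stab_blocks fr); apply: stab_blocks_bij.
Qed.
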